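(* Let $\Omega\subseteq\mathbb{H}$ be a non-empty circular domain, let $f=f_0+f_v\in\mathcal{SR}(\Omega)$ and let $q_0\in\Omega$. (1) If $f_v^s(q_0)=0$, then $$\exp_*(f)(q_0)=\exp_*(f_0)(q_0)\left(1+f_v(q_0)\right).$$ (2) If $f_v^s(q_0)$ is a positive real number and $x_0$ denotes one of the square roots of $f_v^s(q_0)$, then $$\exp_*(f)(q_0)=\exp_*(f_0)(q_0)\left(\cos x_0+\frac{\sin x_0}{x_0}f_v(q_0)\right).$$ (3) If $f_v^s(q_0)$ is a negative real number and $x_0$ denotes one of the square roots of $-f_v^s(q_0)$, then $$\exp_*(f)(q_0)=\exp_*(f_0)(q_0)\left(\cosh x_0+\frac{\sinh x_0}{x_0}f_v(q_0)\right).$$ (4) If $f_v^s(q_0)=\alpha_0+\beta_0J$ with $\alpha_0,\beta_0\in\mathbb{R}$, $J\in\mathbb{S}$ and $\beta_0\neq0$, and $a_0+b_0J$ ($a_0,b_0\in\mathbb{R}$) denotes one of the square roots of $f_v^s(q_0)$, then $$\exp_*(f)(q_0)=\exp_*(f_0)(q_0)\left(\cos(a_0+b_0J)+\frac{\sin(a_0+b_0J)}{a_0+b_0J}f_v(q_0)\right).$$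
   Context: $\mathbb{H}$ is the algebra of quaternions (with the Euclidean topology of $\mathbb{R}^4$), with conjugation $q\mapsto q^c$, $\mathbb{S}=\{q\in\mathbb{H}: q^2=-1\}$, and $\mathbb{C}_J=\mathrm{Span}_{\mathbb{R}}(1,J)$ for $J\in\mathbb{S}$. For $D\subseteq\mathbb{C}=\{\alpha+\imath\beta:\alpha,\beta\in\mathbb{R}\}$ invariant under complex conjugation, $\Omega_D=\{\alpha+\beta I:\alpha+\imath\beta\in D,\ I\in\mathbb{S}\}$; sets of this form are called circular, and a circular domain is a connected open circular subset of $\mathbb{H}$. A stem function is $F=F_1+\imath F_2:D\to\mathbb{H}\otimes_{\mathbb{R}}\mathbb{C}$ ($F_1,F_2$ $\mathbb{H}$-valued) with $F(\overline z)=\overline{F(z)}$, where $\overline{p+\imath q}=p-\imath q$. It induces the slice function $f=\mathcal{I}(F):\Omega_D\to\mathbb{H}$, $f(\alpha+\beta I)=F_1(\alpha+\imath\beta)+I F_2(\alpha+\imath\beta)$. On a circular domain $\Omega=\Omega_D$, $f=\mathcal I(F)$ is slice-regular if $F$ is holomorphic for the natural complex structures of $\mathbb{C}$ and $\mathbb{H}\otimes_{\mathbb{R}}\mathbb{C}$; $\mathcal{SR}(\Omega)$ is the set of slice-regular functions. The $*$-product is $\mathcal I(F)*\mathcal I(G)=\mathcal I(FG)$, with $(p+\imath q)(p'+\imath q')=pp'-qq'+\imath(pq'+qp')$. For $f=\mathcal I(F_1+\imath F_2)\in\mathcal{SR}(\Omega)$: $f^c=\mathcal I(F_1^c+\imath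 F_2^c)$, $f_0=\frac{f+f^c}{2}$, $f_v=\frac{f-f^c}{2}$ (so $f=f_0+f_v$), $f^s=f*f^c$, and $f_v^s$ means $(f_v)^s$. The $*$-exponential is $\exp_*(f)=\sum_{n\in\mathbb{N}}\frac{f^{*n}}{n!}$ ($f^{*n}$ the $n$-th $*$-power, $f^{*0}=1$), which converges uniformly on compact subsets of $\Omega$ to an element of $\mathcal{SR}(\Omega)$. On quaternions, $\cos$ and $\sin$ are given by the usual power series (so on $\mathbb{C}_J\cong\mathbb{C}$ they are the complex cosine and sine); the quotient $\frac{\sin(a_0+b_0J)}{a_0+b_0J}$ is taken in the field $\mathbb{C}_J$. *)

(* Defs.v *)
From HB Require Import structures.
From mathcomp Require Import all_boot all_order all_algebra ring.
From mathcomp Require Import all_classical all_reals all_analysis.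
From mathcomp Require Import complex.

Set Implicit Arguments.
Unset Strict Implicit.
Unset Printing Implicit Defensive.

Import Order.TTheory GRing.Theory Num.Theory.
Import numFieldNormedType.Exports.

Local Open Scope classical_set_scope.
Local Open Scope ring_scope.

(* The quaternion algebra with coefficients in K. For K = R it is the skew
   field H; for K = R[i] it is the complexification H (x)_R C, whose complex
   structure is the scalar multiplication by 'i (see [qtensM], [qtens_scale]).
   It carries the l1 norm, whose topology is the usual one on K^4; for K = R,
   this is the Euclidean topology. *)
Record quat (K : numFieldType) := Quat { co1 : K; coi : K; coj : K; cok : K }.

Section QuatAlgebra.
Variable K : numFieldType.
Implicit Types (p q : quat K) (x : K).

Definition quat_tuple q := (co1 q, coi q, coj q, cok q).
Definition tuple_quat (t : K * K * K * K) :=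
  let: (a, b, c, d) := t in Quat a b c d.
Fact quat_tupleK : cancel quat_tuple tuple_quat. Proof. by case. Qed.

HB.instance Definition _ := Choice.copy (quat K) (can_type quat_tupleK).

Lemma eq_quat p q : co1 p = co1 q -> coi p = coi q -> coj p = coj q ->
  cok p = cok q -> p = q.
Proof. by case: p q => [????] [????] /= -> -> -> ->. Qed.

Definition addq p q :=
  Quat (co1 p + co1 q) (coi p + coi q) (coj p + coj q) (cok p + cok q).
Definition oppq q := Quat (- co1 q) (- coi q) (- coj q) (- cok q).

Fact addqA : associative addq.
Proof. by move=> *; apply: eq_quat => /=; ring. Qed.
Fact addqC : commutative addq.
Proof. by move=> *; apply: eq_quat => /=; ring. Qed.
Fact add0q : left_id (Quat 0 0 0 0) addq.
Proof. by move=> *; apply: eq_quat => /=; ring. Qed.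
Fact addNq : left_inverse (Quat 0 0 0 0) oppq addq.
Proof. by move=> *; apply: eq_quat => /=; ring. Qed.

HB.instance Definition _ :=
  GRing.isZmodule.Build (quat K) addqA addqC add0q addNq.

Definition mulq p q := Quat
  (co1 p * co1 q - coi p * coi q - coj p * coj q - cok p * cok q)
  (co1 p * coi q + coi p * co1 q + coj p * cok q - cok p * coj q)
  (co1 p * coj q - coi p * cok q + coj p * co1 q + cok p * coi q)
  (co1 p * cok q + coi p * coj q - coj p * coi q + cok p * co1 q).

Fact mulqA : associative mulq.
Proof. by move=> *; apply: eq_quat => /=; ring. Qed.
Fact mul1q : left_id (Quat 1 0 0 0) mulq.
Proof. by move=> *; apply: eq_quat => /=; ring. Qed.
Fact mulq1 : right_id (Quat 1 0 0 0) mulq.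
Proof. by move=> *; apply: eq_quat => /=; ring. Qed.
Fact mulqDl : left_distributive mulq +%R.
Proof. by move=> *; apply: eq_quat => /=; ring. Qed.
Fact mulqDr : right_distributive mulq +%R.
Proof. by move=> *; apply: eq_quat => /=; ring. Qed.
Fact oneq_neq0 : Quat 1 0 0 0 != 0 :> quat K.
Proof. by apply/eqP => -[/eqP]; rewrite oner_eq0. Qed.

HB.instance Definition _ := GRing.Zmodule_isNzRing.Build (quat K)
  mulqA mul1q mulq1 mulqDl mulqDr oneq_neq0.

Definition scaleq x q := Quat (x * co1 q) (x * coi q) (x * coj q) (x * cok q).

Fact scaleqA x y q : scaleq x (scaleq y q) = scaleq (x * y) q.
Proof. by apply: eq_quat => /=; ring. Qed.
Fact scale1q : left_id 1 scaleq.
Proof. by move=> *; apply: eq_quat => /=; ring. Qed.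
Fact scaleqDr : right_distributive scaleq +%R.
Proof. by move=> *; apply: eq_quat => /=; ring. Qed.
Fact scaleqDl q : {morph scaleq^~ q : x y / x + y}.
Proof. by move=> *; apply: eq_quat => /=; ring. Qed.

HB.instance Definition _ := GRing.Zmodule_isLmodule.Build K (quat K)
  scaleqA scale1q scaleqDr scaleqDl.

Lemma co0q : (co1 (0 : quat K) = 0) * (coi (0 : quat K) = 0) *
  (coj (0 : quat K) = 0) * (cok (0 : quat K) = 0).
Proof. by []. Qed.

Lemma co1q : (co1 (1 : quat K) = 1) * (coi (1 : quat K) = 0) *
  (coj (1 : quat K) = 0) * (cok (1 : quat K) = 0).
Proof. by []. Qed.

Lemma coDq p q :
  (co1 (p + q) = co1 p + co1 q) * (coi (p + q) = coi p + coi q) *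
  (coj (p + q) = coj p + coj q) * (cok (p + q) = cok p + cok q).
Proof. by []. Qed.

Lemma coNq q : (co1 (- q) = - co1 q) * (coi (- q) = - coi q) *
  (coj (- q) = - coj q) * (cok (- q) = - cok q).
Proof. by []. Qed.

Lemma coZq x q : (co1 (x *: q) = x * co1 q) * (coi (x *: q) = x * coi q) *
  (coj (x *: q) = x * coj q) * (cok (x *: q) = x * cok q).
Proof. by []. Qed.

Lemma coMq p q :
  (co1 (p * q) =
    co1 p * co1 q - coi p * coi q - coj p * coj q - cok p * cok q) *
  (coi (p * q) =
    co1 p * coi q + coi p * co1 q + coj p * cok q - cok p * coj q) *
  (coj (p * q) =
    co1 p * coj q - coi p * cok q + coj p * co1 q + cok p * coi q) *
  (cok (p * q) =
    co1 p * cok q + coi p * coj q - coj p * coi q + cok p * co1 q).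
Proof. by []. Qed.

Definition coE := (co0q, co1q, coDq, coNq, coZq, coMq).

Fact scaleqAl x p q : x *: (p * q) = x *: p * q.
Proof. by apply: eq_quat; rewrite !coE; ring. Qed.

HB.instance Definition _ :=
  GRing.Lmodule_isLalgebra.Build K (quat K) scaleqAl.

Fact scaleqAr x p q : x *: (p * q) = p * (x *: q).
Proof. by apply: eq_quat; rewrite !coE; ring. Qed.

HB.instance Definition _ := GRing.Lalgebra_isAlgebra.Build K (quat K) scaleqAr.

Definition qconj q := Quat (co1 q) (- coi q) (- coj q) (- cok q).

Definition qnormsq q : K := co1 q ^+ 2 + coi q ^+ 2 + coj q ^+ 2 + cok q ^+ 2.

Lemma mulq_conj q : q * qconj q = (qnormsq q)%:A.
Proof. by apply: eq_quat; rewrite !coE /qnormsq /=; ring. Qed.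

Lemma mulq_conjl q : qconj q * q = (qnormsq q)%:A.
Proof. by apply: eq_quat; rewrite !coE /qnormsq /=; ring. Qed.

Lemma qconjM p q : qconj (p * q) = qconj q * qconj p.
Proof. by apply: eq_quat; rewrite !coE /= ?coE; ring. Qed.

Lemma qnormsqM p q : qnormsq (p * q) = qnormsq p * qnormsq q.
Proof. by rewrite /qnormsq !coE; ring. Qed.

Definition unitq : {pred quat K} := fun q => qnormsq q != 0.

(* For K real this is the inverse of the skew field H, so that for J in the
   sphere of imaginary units it restricts to the inverse of the field C_J. *)
Definition invq q := if q \in unitq then (qnormsq q)^-1 *: qconj q else q.

Fact mulVq : {in unitq, left_inverse 1 invq *%R}.
Proof.
move=> q uq; rewrite /invq uq -scalerAl mulq_conjl.
by rewrite scalerA mulVf ?scale1r.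
Qed.

Fact mulqV : {in unitq, right_inverse 1 invq *%R}.
Proof.
move=> q uq; rewrite /invq uq -scalerAr mulq_conj.
by rewrite scalerA mulVf ?scale1r.
Qed.

Fact unitqP p q : q * p = 1 /\ p * q = 1 -> unitq p.
Proof.
case=> _ pq1; apply/eqP => p0; have /eqP := qnormsqM p q.
by rewrite pq1 p0 mul0r /qnormsq !coE !expr0n /= !addr0 expr1n oner_eq0.
Qed.

Fact invq_out : {in [predC unitq], invq =1 id}.
Proof. by move=> q; rewrite inE /invq => /negPf ->. Qed.

HB.instance Definition _ :=
  GRing.NzRing_hasMulInverse.Build (quat K) mulVq mulqV unitqP invq_out.

Definition normq q : K := `|co1 q| + `|coi q| + `|coj q| + `|cok q|.

Fact ler_normqD p q : normq (p + q) <= normq p + normq q.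
Proof.
rewrite /normq !coE; apply: le_trans (_ : (`|co1 p| + `|co1 q|) +
  (`|coi p| + `|coi q|) + (`|coj p| + `|coj q|) + (`|cok p| + `|cok q|) <= _).
  by rewrite !lerD ?ler_normD.
by rewrite le_eqVlt; apply/orP; left; apply/eqP; ring.
Qed.

Fact normqZ x q : normq (x *: q) = `|x| * normq q.
Proof. by rewrite /normq !coE !normrM !mulrDr. Qed.

Fact normq0_eq0 q : normq q = 0 -> q = 0.
Proof.
move=> /eqP; rewrite !paddr_eq0 ?addr_ge0 ?normr_ge0// !normr_eq0.
by move=> /andP[/andP[/andP[/eqP ? /eqP ?] /eqP ?] /eqP ?]; apply: eq_quat.
Qed.

HB.instance Definition _ :=
  Lmodule_isNormed.Build K (quat K) ler_normqD normqZ normq0_eq0.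

End QuatAlgebra.

Definition cosh (R : realType) (x : R) : R := (expR x + expR (- x)) / 2.
Definition sinh (R : realType) (x : R) : R := (expR x - expR (- x)) / 2.

Section Quaternions.
Variable R : realType.
Local Notation C := R[i].
Local Notation H := (quat R).

Definition qsphere : set H := [set q | q ^+ 2 = -1].

Definition qcos (q : H) : H :=
  limn (series (fun n => ((-1) ^+ n / (n.*2)`!%:R) *: q ^+ n.*2)).
Definition qsin (q : H) : H :=
  limn (series (fun n => ((-1) ^+ n / (n.*2.+1)`!%:R) *: q ^+ n.*2.+1)).

(* the element p + \imath q of H (x) C, and its components *)
Definition qtens (p q : H) : quat C :=
  Quat (Complex (co1 p) (co1 q)) (Complex (coi p) (coi q))
       (Complex (coj p) (coj q)) (Complex (cok p) (cok q)).
Definition tens1 (w : quat C) : H :=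
  Quat (complex.Re (co1 w)) (complex.Re (coi w)) (complex.Re (coj w)) (complex.Re (cok w)).
Definition tens2 (w : quat C) : H :=
  Quat (complex.Im (co1 w)) (complex.Im (coi w)) (complex.Im (coj w)) (complex.Im (cok w)).

Lemma qtens1K p q : tens1 (qtens p q) = p.
Proof. exact: eq_quat. Qed.
Lemma qtens2K p q : tens2 (qtens p q) = q.
Proof. exact: eq_quat. Qed.
Lemma qtensK w : qtens (tens1 w) (tens2 w) = w.
Proof. by case: w => [[? ?] [? ?] [? ?] [? ?]]. Qed.

Lemma qtensD p q p' q' : qtens p q + qtens p' q' = qtens (p + p') (q + q').
Proof. exact: eq_quat. Qed.

Lemma qtensM p q p' q' :
  qtens p q * qtens p' q' = qtens (p * p' - q * q') (p * q' + q * p').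
Proof.
by apply: eq_quat; apply/eqP; rewrite eq_complex /=; apply/andP; split;
  apply/eqP; ring.
Qed.

Lemma qtens_scale (x y : R) p q :
  Complex x y *: qtens p q = qtens (x *: p - y *: q) (x *: q + y *: p).
Proof. by apply: eq_quat; congr Complex; rewrite /=; ring. Qed.

(* p + \imath q |-> p - \imath q *)
Definition tensbar (w : quat C) : quat C := qtens (tens1 w) (- tens2 w).

Lemma tensbarD : {morph tensbar : v w / v + w}.
Proof.
by move=> v w; rewrite -[v]qtensK -[w]qtensK /tensbar !(qtensD, qtens1K, qtens2K) opprD.
Qed.

Lemma tensbarM : {morph tensbar : v w / v * w}.
Proof.
move=> v w; rewrite -[v]qtensK -[w]qtensK /tensbar !(qtensM, qtens1K, qtens2K).
by rewrite mulrNN mulrN mulNr opprD.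
Qed.

Lemma tensbarZ (x : R) w : tensbar (Complex x 0 *: w) = Complex x 0 *: tensbar w.
Proof.
rewrite -[w]qtensK /tensbar !(qtens_scale, qtens1K, qtens2K).
by rewrite !scale0r oppr0 !addr0 scalerN.
Qed.

(* (p + \imath q)^c = p^c + \imath q^c *)
Definition tensconj (w : quat C) : quat C :=
  qtens (qconj (tens1 w)) (qconj (tens2 w)).

Lemma tensbar_conj w : tensbar (tensconj w) = tensconj (tensbar w).
Proof. by rewrite /tensbar /tensconj !qtens1K !qtens2K; apply: eq_quat. Qed.

(* \Omega_D *)
Definition circularization (D : set C) : set H :=
  [set q | exists a b I, [/\ D (Complex a b), qsphere I & q = a%:A + b *: I]].

Definition circular_domain (D : set C) : Prop :=
  [/\ (forall z, D z -> D (conjc z)),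
      open (circularization D) & connected (circularization D)].

(* A slice function on \Omega_D is represented by the stem function inducing
   it, which is unique on D; the values of [stem] outside of D are junk. *)
Record slice_fun (D : set C) := SliceFun {
  stem : C -> quat C ;
  stem_bar : forall z, D z -> stem (conjc z) = tensbar (stem z) }.

Section SliceFunctions.
Variable D : set C.
Implicit Types f g : slice_fun D.

(* \mathcal{I}(F)(q), computed from the representation q = a + b I with b >= 0;
   see [slice_evalE]. On the real axis, any I would do. *)
Definition slice_eval f (q : H) : H :=
  let v := q - (co1 q)%:A in
  let b := Num.sqrt (qnormsq v) in
  let I := if b == 0 then Quat 0 1 0 0 else b^-1 *: v in
  let z := Complex (co1 q) b in
  tens1 (stem f z) + I * tens2 (stem f z).

Lemma qsphereP (I : H) :
  qsphere I <-> co1 I = 0 /\ coi I ^+ 2 + coj I ^+ 2 + cok I ^+ 2 = 1.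
Proof.
rewrite /qsphere /= expr2; split=> [I2|[I0 I1]]; last first.
  apply: eq_quat; rewrite !coE I0 ?oppr0; try ring.
  by rewrite -I1; ring.
have := congr1 (@co1 _) I2; have := congr1 (@coi _) I2.
have := congr1 (@coj _) I2; have := congr1 (@cok _) I2.
rewrite !coE !oppr0 => ek ej ei e1.
have h0 x : co1 I * x + x * co1 I = 0 -> co1 I * x = 0.
  by rewrite mulrC -mulr2n => /eqP; rewrite mulrn_eq0 /= mulrC => /eqP.
have hi : co1 I * coi I = 0 by apply: h0; rewrite -[RHS]ei; ring.
have hj : co1 I * coj I = 0 by apply: h0; rewrite -[RHS]ej; ring.
have hk : co1 I * cok I = 0 by apply: h0; rewrite -[RHS]ek; ring.
have I0 : co1 I = 0.
  apply/eqP; apply/negPn/negP => n0.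
  move/eqP: hi; rewrite mulf_eq0 (negPf n0) => /eqP i0.
  move/eqP: hj; rewrite mulf_eq0 (negPf n0) => /eqP j0.
  move/eqP: hk; rewrite mulf_eq0 (negPf n0) => /eqP k0.
  move: e1; rewrite i0 j0 k0 !mulr0 !subr0 => e1.
  by have := sqr_ge0 (co1 I); rewrite expr2 e1 oppr_ge0 ler10.
by split=> //; apply: oppr_inj; rewrite -e1 I0; ring.
Qed.

Lemma slice_evalE f (a b : R) (I : H) : D (Complex a b) -> qsphere I ->
  slice_eval f (a%:A + b *: I) =
  tens1 (stem f (Complex a b)) + I * tens2 (stem f (Complex a b)).
Proof.
move=> Dz /qsphereP[I0 I1]; rewrite /slice_eval.
have -> : co1 (a%:A + b *: I) = a by rewrite !coE I0; ring.
have -> : a%:A + b *: I - a%:A = b *: I by rewrite addrC addKr.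
have -> : qnormsq (b *: I) = b ^+ 2.
  by rewrite /qnormsq !coE I0 -[RHS]mulr1 -I1; ring.
rewrite sqrtr_sqr normr_eq0.
have [b0|bN0] := eqVneq b 0.
  subst b; rewrite normr0; have := stem_bar f Dz; rewrite /= oppr0.
  move=> /(congr1 tens2); rewrite /tensbar qtens2K => /eqP.
  rewrite -addr_eq0 -mulr2n -scaler_nat scaler_eq0 pnatr_eq0 /= => /eqP ->.
  by rewrite !mulr0.
have [b_ge0|b_lt0] := leP 0 b.
  by rewrite ger0_norm// scalerA mulVf// scale1r.
rewrite ltr0_norm// scalerA invrN mulNr mulVf// scaleN1r.
have /= -> := stem_bar f Dz.
by rewrite /tensbar qtens1K qtens2K mulrNN.
Qed.

(* complex differentiability, H (x) C being a normed space over C *)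
Definition slice_regular f : Prop :=
  forall z, D z -> derivable (stem f : C^o -> quat C) z 1.

Fact stem_bar1 z : D z -> 1 = tensbar 1.
Proof. by move=> _; apply: eq_quat; rewrite /= ?oppr0. Qed.
Definition slice_one : slice_fun D := SliceFun stem_bar1.

Fact stem_barD f g z : D z ->
  stem f (conjc z) + stem g (conjc z) = tensbar (stem f z + stem g z).
Proof. by move=> Dz; rewrite tensbarD !stem_bar. Qed.
Definition slice_add f g : slice_fun D := SliceFun (@stem_barD f g).

Fact stem_barZ (x : R) f z : D z ->
  Complex x 0 *: stem f (conjc z) = tensbar (Complex x 0 *: stem f z).
Proof. by move=> Dz; rewrite tensbarZ stem_bar. Qed.
Definition slice_scale x f : slice_fun D := SliceFun (@stem_barZ x f).

Fact stem_barM f g z : D z ->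
  stem f (conjc z) * stem g (conjc z) = tensbar (stem f z * stem g z).
Proof. by move=> Dz; rewrite tensbarM !stem_bar. Qed.
Definition star f g : slice_fun D := SliceFun (@stem_barM f g).

Fact stem_barc f z : D z ->
  tensconj (stem f (conjc z)) = tensbar (tensconj (stem f z)).
Proof. by move=> Dz; rewrite tensbar_conj stem_bar. Qed.
Definition slice_conj f : slice_fun D := SliceFun (@stem_barc f).

Definition slice_re f := slice_scale 2^-1 (slice_add f (slice_conj f)).
Definition slice_vec f :=
  slice_scale 2^-1 (slice_add f (slice_scale (-1) (slice_conj f))).
Definition slice_sym f := star f (slice_conj f).

Definition star_pow f n : slice_fun D := iter n (star f) slice_one.

(* The *-exponential, as the pointwise sum of its series (which converges
   uniformly on compact sets). *)
Definition star_exp f (q : H) : H :=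
  limn (series (fun n => n`!%:R^-1 *: slice_eval (star_pow f n) q)).

End SliceFunctions.
End Quaternions.

Coercion slice_eval : slice_fun >-> Funclass.

(* Main.v *)
Require Import Defs.
From mathcomp Require Import all_boot all_order all_algebra ring lra.
From mathcomp Require Import all_classical all_reals all_analysis.
From mathcomp Require Import complex.
From HB Require Import structures.

Import Order.TTheory GRing.Theory Num.Theory.
Import numFieldNormedType.Exports.

Local Open Scope classical_set_scope.
Local Open Scope ring_scope.

(** At a fixed point [q0 = a + b I], evaluating a slice function is applying
    the real-linear map [p + \imath q |-> p + I q] to the value [w] of its stem
    function at [a + \imath b].  This map, [tens_eval I], is not multiplicative on
    the complexified quaternions, but it is linear over the complex scalars once
    [\imath] acts on the left as [I] ([tens_evalZ]).  The whole statement is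
    therefore about the powers of one element [w].

    Split [w = w0 + u] into its scalar and vector parts; they are the values of
    the stem functions of [f_0] and [f_v].  The scalar [w0] is central, and
    [u ^ 2 = - s] is a scalar too, where [s] is the value of the stem function of
    [f_v^s].  By the binomial formula the exponential series of [w] is the Cauchy
    product of those of [w0] and [u], and the central powers of [w0] come out of
    [tens_eval I] as powers of [f_0(q0)]: this gives the factor
    [exp_*(f_0)(q0)].  In the exponential series of [u], the terms of even and of
    odd degree are powers of [- s], respectively powers of [- s] times [u], so
    with [S = f_v^s(q0)] the second factor is
    [sum (- S)^n / (2n)! + (sum (- S)^n / (2n+1)!) f_v(q0)]; this is
    [star_exp_re_vec].  The four cases only differ in how these two series are
    summed: they are [1] and [1] for [S = 0], the real cosine and cardinal sine of
    a square root of [S] for [S > 0], their hyperbolic analogues for [S < 0], and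
    the quaternionic [cos X] and [sin X / X] for [S = X ^ 2] not real.

    Everything converges because the l1 norm is submultiplicative
    ([ler_norm_quatM]) and all series are dominated by real exponential series;
    even the Cauchy product theorem [cvg_cauchy_prod] is reduced in this way to
    [exp (x + y) = exp x * exp y] in the reals. *)

(** * Norm and convergence in the quaternions *)

Section QuatTopology.
Context {R : realType}.
Local Notation H := (quat R).

Lemma norm_quatE (q : H) : `|q| = `|co1 q| + `|coi q| + `|coj q| + `|cok q|.
Proof. by []. Qed.

(** The product of two of the units 1, i, j, k is again one of them up to sign,
    which makes the l1 norm submultiplicative. *)
Lemma ler_norm_quatM (p q : H) : `|p * q| <= `|p| * `|q|.
Proof.
have norm4 (x y z t : R) : `|x + y + z + t| <= `|x| + `|y| + `|z| + `|t|.
  by apply: (le_trans (ler_normD _ _)); rewrite lerD2r;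
     apply: (le_trans (ler_normD _ _)); rewrite lerD2r ler_normD.
rewrite !norm_quatE !coE.
have := norm4 (co1 p * co1 q) (- (coi p * coi q)) (- (coj p * coj q)) (- (cok p * cok q)).
have := norm4 (co1 p * coi q) (coi p * co1 q) (coj p * cok q) (- (cok p * coj q)).
have := norm4 (co1 p * coj q) (- (coi p * cok q)) (coj p * co1 q) (cok p * coi q).
have := norm4 (co1 p * cok q) (coi p * coj q) (- (coj p * coi q)) (cok p * co1 q).
by rewrite !normrN !normrM; lra.
Qed.

Lemma norm_quat1 : `|1 : H| = 1.
Proof. by rewrite norm_quatE !coE normr1 normr0 !addr0. Qed.

Lemma ler_norm_quatX (p : H) n : `|p ^+ n| <= `|p| ^+ n.
Proof.
elim: n => [|n IH]; first by rewrite !expr0 norm_quat1.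
by rewrite !exprS; apply: (le_trans (ler_norm_quatM _ _)); apply: ler_wpM2l.
Qed.

Lemma norm_co (q : H) :
  [/\ `|co1 q| <= `|q|, `|coi q| <= `|q|, `|coj q| <= `|q| & `|cok q| <= `|q|].
Proof.
have := normr_ge0 (co1 q); have := normr_ge0 (coi q).
have := normr_ge0 (coj q); have := normr_ge0 (cok q).
by split; rewrite norm_quatE; lra.
Qed.

(** Convergence is checked on coordinates, which brings products and sums of
    series back to the field of real numbers and its completeness. *)
Lemma cvg_quatP {T : Type} {F : set_system T} {FF : Filter F} (u : T -> H) (l : H) :
  u @ F --> l <->
  [/\ co1 (u t) @[t --> F] --> co1 l, coi (u t) @[t --> F] --> coi l,
      coj (u t) @[t --> F] --> coj l & cok (u t) @[t --> F] --> cok l].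
Proof.
split=> [ul|[c1 ci cj ck]].
  have C (c : H -> R) : {morph c : p q / p - q} -> (forall q, `|c q| <= `|q|) ->
      c (u t) @[t --> F] --> c l.
    move=> cB cq; apply/cvgrPdist_lt => e e0.
    near=> t; rewrite /= -cB; apply: (le_lt_trans (cq _)); near: t.
    by move/cvgrPdist_lt : ul; apply.
  by split; apply: C => // q; case: (norm_co q).
have -> : u = fun t => co1 (u t) *: 1 + coi (u t) *: Quat 0 1 0 0 +
    coj (u t) *: Quat 0 0 1 0 + cok (u t) *: Quat 0 0 0 1.
  by apply/funext => t; apply: eq_quat; rewrite !coE /=; ring.
have -> : l = co1 l *: 1 + coi l *: Quat 0 1 0 0 +
    coj l *: Quat 0 0 1 0 + cok l *: Quat 0 0 0 1.
  by apply: eq_quat; rewrite !coE /=; ring.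
by apply: cvgD; [apply: cvgD; [apply: cvgD|]|]; apply: cvgZr_tmp.
Unshelve. all: by end_near. Qed.

Lemma cvg_quatM {T : Type} {F : set_system T} {FF : Filter F} (u v : T -> H) (l m : H) :
  u @ F --> l -> v @ F --> m -> (fun t => u t * v t) @ F --> l * m.
Proof.
move=> /cvg_quatP[u1 ui uj uk] /cvg_quatP[v1 vi vj vk]; apply/cvg_quatP.
split.
- by apply: cvgB; [apply: cvgB; [apply: cvgB|]|]; apply: cvgM.
- by apply: cvgB; [apply: cvgD; [apply: cvgD|]|]; apply: cvgM.
- by apply: cvgD; [apply: cvgD; [apply: cvgB|]|]; apply: cvgM.
- by apply: cvgD; [apply: cvgB; [apply: cvgD|]|]; apply: cvgM.
Qed.

(** The real series [M * r ^ n / n!] is the majorant of the quaternionic series below. *)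
Lemma cvg_series_expM (M r : R) :
  series (fun n => M * (r ^+ n / n`!%:R)) @ \oo --> M * expR r.
Proof.
have -> : series (fun n => M * (r ^+ n / n`!%:R)) =
    (fun n => M * series (exp_coeff r) n).
  by apply/funext => n; rewrite /series/= mulr_sumr.
by apply: cvgMl_tmp; exact: is_cvg_series_exp_coeff.
Qed.

Lemma is_cvg_quat_series_exp (u : nat -> H) (M r : R) :
  (forall n, `|u n| <= M * (r ^+ n / n`!%:R)) -> cvgn (series u).
Proof.
move=> uM.
have C (c : H -> R) : {morph c : p q / p + q} -> c 0 = 0 ->
    (forall q, `|c q| <= `|q|) ->
    (c \o series u) @ \oo --> limn (series (c \o u)).
  move=> cD c0 cq.
  have -> : c \o series u = series (c \o u).
    by apply/funext => n; rewrite /series/= (big_morph c cD c0).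
  apply: normed_cvg.
  apply: series_le_cvg (_ : cvgn (series (fun n => M * (r ^+ n / n`!%:R)))) => //=.
  - by move=> n; apply: le_trans (uM n).
  - by move=> n; apply: le_trans (cq _) (uM n).
  - by apply: cvgP (cvg_series_expM M r).
have : series u @ \oo --> Quat
    (limn (series (@co1 R \o u))) (limn (series (@coi R \o u)))
    (limn (series (@coj R \o u))) (limn (series (@cok R \o u))).
  by apply/cvg_quatP; split=> /=; apply: C => // q; case: (norm_co q).
exact: cvgP.
Qed.

Lemma cvg_series_scalar (a : nat -> R) (l : R) :
  series a @ \oo --> l -> series (fun n => (a n)%:A : H) @ \oo --> (l%:A : H).
Proof.
move=> al; have -> : series (fun n => (a n)%:A : H) = (fun n => (series a n)%:A).
  by apply/funext => n; rewrite /series/= scaler_suml.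
exact: cvgZr_tmp.
Qed.

End QuatTopology.

(** * Even and odd partial sums *)

Lemma cvg_doublen : (fun n => n.*2) @ \oo --> \oo.
Proof.
apply/cvgnyPge => A; near=> n; rewrite -addnn.
apply: (@leq_trans n); last by rewrite leq_addr.
by near: n; exact: nbhs_infty_ge.
Unshelve. all: by end_near. Qed.

Lemma series_double (V : zmodType) (u : nat -> V) n :
  series u n.*2 =
  series (fun k => u k.*2) n + series (fun k => u k.*2.+1) n.
Proof.
elim: n => [|n IH]; first by rewrite /series/= !big_geq// addr0.
rewrite doubleS /series/= !big_nat_recr//=.
by rewrite /series/= in IH; rewrite IH -!addrA; congr (_ + _); rewrite addrCA.
Qed.

(** * Cauchy products *)

Section CauchyProduct.
Context {A : nzRingType}.

Definition cauchy_prod (a b : nat -> A) n := \sum_(i < n.+1) a (n - i)%N * b i.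

Lemma series_cauchy_prod a b N :
  series (cauchy_prod a b) N = \sum_(j < N) series a (N - j)%N * b j.
Proof.
elim: N => [|N IH]; first by rewrite /series/= big_geq// big_ord0.
have := IH; rewrite /series/= big_nat_recr//= => ->.
rewrite [RHS]big_ord_recr/= subSnn big_nat1 /cauchy_prod [X in _ + X]big_ord_recr/=.
rewrite subnn addrA -big_split/=; congr (_ + _); apply: eq_bigr => j _.
by rewrite subSn 1?ltnW// big_nat_recr//= mulrDl.
Qed.

(** The defect is written with terms [a i * b j] only, with nonnegative
    coefficients: for this reason it is monotone under termwise majorization,
    which [cvg_cauchy_defect] exploits. *)
Lemma cauchy_defect a b N : series a N * series b N - series (cauchy_prod a b) N =
  \sum_(j < N) (\sum_((N - j)%N <= i < N) a i) * b j.
Proof.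
rewrite series_cauchy_prod /series/= [X in _ * X]big_mkord mulr_sumr -sumrB.
apply: eq_bigr => j _; rewrite -mulrBl; congr (_ * _).
by rewrite (@big_cat_nat _ _ _ (N - j)%N 0 N) ?leq_subr// addrAC subrr add0r.
Qed.

End CauchyProduct.

Section Mertens.
Context {R : realType}.
Local Notation H := (quat R).

(** The norm of the defect is at most the defect of the two real majorants.  The
    latter tends to [exp x * (M * exp y) - M * exp (x + y) = 0], the Cauchy
    product of two real exponential series being known by the binomial
    formula. *)
Lemma cvg_cauchy_defect (a b : nat -> H) (x M y : R) :
  (forall n, `|a n| <= x ^+ n / n`!%:R) ->
  (forall n, `|b n| <= M * (y ^+ n / n`!%:R)) ->
  (fun N => series a N * series b N - series (cauchy_prod a b) N) @ \oo --> (0 : H).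
Proof.
move=> ax bM.
pose al n := x ^+ n / n`!%:R; pose be n := M * (y ^+ n / n`!%:R).
have alE : series al @ \oo --> expR x.
  exact: is_cvg_series_exp_coeff.
have beE : series be @ \oo --> M * expR y := cvg_series_expM M y.
have abE : series (cauchy_prod al be) @ \oo --> M * expR (x + y).
  have -> : cauchy_prod al be = (fun n => M * ((x + y) ^+ n / n`!%:R)).
    apply/funext => n; rewrite /cauchy_prod /al /be exprDn mulr_suml mulr_sumr.
    apply: eq_bigr => i _.
    have ni : (i <= n)%N by rewrite -ltnS.
    rewrite -(bin_fact ni) !natrM -mulr_natr.
    have C0 : 'C(n, i)%:R != 0 :> R by rewrite pnatr_eq0 -lt0n bin_gt0.
    have i0 : i`!%:R != 0 :> R by rewrite pnatr_eq0 -lt0n fact_gt0.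
    have n0 : (n - i)`!%:R != 0 :> R by rewrite pnatr_eq0 -lt0n fact_gt0.
    by field; rewrite C0 i0 n0.
  exact: cvg_series_expM.
apply: norm_cvg0; apply: (@squeeze_cvgr _ _ _ _ (cst 0)
  (fun N => series al N * series be N - series (cauchy_prod al be) N)).
- apply: nearW => N; rewrite normr_ge0 /= !cauchy_defect.
  apply: (le_trans (ler_norm_sum _ _ _)); apply: ler_sum => j _.
  apply: (le_trans (ler_norm_quatM _ _)); apply: ler_pM => //.
  by apply: (le_trans (ler_norm_sum _ _ _)); apply: ler_sum.
- exact: cvg_cst.
- have -> : 0 = expR x * (M * expR y) - M * expR (x + y) by rewrite expRD; ring.
  by apply: cvgB => //; apply: cvgM.
Qed.

Lemma cvg_cauchy_prod (a b : nat -> H) (x M y : R) (A B : H) :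
  (forall n, `|a n| <= x ^+ n / n`!%:R) ->
  (forall n, `|b n| <= M * (y ^+ n / n`!%:R)) ->
  series a @ \oo --> A -> series b @ \oo --> B ->
  series (cauchy_prod a b) @ \oo --> A * B.
Proof.
move=> ax bM aA bB.
have D := cvg_cauchy_defect _ _ _ _ _ ax bM.
have P : (fun N => series a N * series b N) @ \oo --> A * B by exact: cvg_quatM.
rewrite -[A * B]subr0.
rewrite (_ : series (cauchy_prod a b) = (fun N => series a N * series b N -
  (series a N * series b N - series (cauchy_prod a b) N))); first exact: (cvgB P D).
by apply/funext => N; rewrite subKr.
Qed.
End Mertens.

(** * Evaluation of stem functions at a point *)

Section StemEvaluation.
Context {R : realType}.
Local Notation C := R[i].
Local Notation H := (quat R).

Definition tens_eval (I : H) (w : quat C) : H := tens1 w + I * tens2 w.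

Fact tens_eval_is_zmod_morphism I : zmod_morphism (tens_eval I).
Proof.
move=> v w; rewrite /tens_eval.
have -> : tens1 (v - w) = tens1 v - tens1 w.
  by apply: eq_quat; rewrite !coE /=;
    case: v w => [[? ?] [? ?] [? ?] [? ?]] [[? ?] [? ?] [? ?] [? ?]].
have -> : tens2 (v - w) = tens2 v - tens2 w.
  by apply: eq_quat; rewrite !coE /=;
    case: v w => [[? ?] [? ?] [? ?] [? ?]] [[? ?] [? ?] [? ?] [? ?]].
by rewrite mulrBr opprD addrACA.
Qed.

HB.instance Definition _ I :=
  GRing.isZmodMorphism.Build (quat C) H (tens_eval I) (tens_eval_is_zmod_morphism I).

Lemma qtens10 : 1 = qtens 1 0 :> quat C.
Proof. exact: eq_quat. Qed.

Lemma tens_eval1 I : tens_eval I 1 = 1.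
Proof. by rewrite qtens10 /tens_eval qtens1K qtens2K mulr0 addr0. Qed.

(** Left multiplication by [\imath] becomes left multiplication by [I], because
    the complex scalar is central and [I ^ 2 = -1].  For a general first factor
    [p + \imath q] the same identity would require [p] and [q] to commute with
    [I]. *)
Lemma tens_evalZ I (c : C) w : qsphere I ->
  tens_eval I (c *: w) = tens_eval I c%:A * tens_eval I w.
Proof.
rewrite /qsphere/= expr2 => II; case: c => x y.
rewrite qtens10 -[w]qtensK !qtens_scale /tens_eval !qtens1K !qtens2K.
rewrite !scaler0 subr0 add0r mulrDr !mulrDl.
rewrite -!scalerAr -!scalerAl !mulr1 !mul1r.
rewrite mulrDr mulrA II mulN1r !scalerDr scalerN.
by rewrite addrACA; congr (_ + _); rewrite addrC.
Qed.

Lemma tens_evalMX I (c : C) w n : qsphere I ->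
  tens_eval I (c%:A ^+ n * w) = tens_eval I c%:A ^+ n * tens_eval I w.
Proof.
move=> II; elim: n => [|n IH]; first by rewrite !expr0 !mul1r.
by rewrite !exprS -!mulrA mulr_algl tens_evalZ// IH.
Qed.

Definition qvec (w : quat C) : quat C := w - (co1 w)%:A.

(** A quaternion without scalar part is the opposite of its conjugate, so its
    square is the opposite of its norm form, also over complex coefficients. *)
Lemma qvec_sqr w : qvec w ^+ 2 = (- qnormsq (qvec w))%:A.
Proof. by apply: eq_quat; rewrite /qnormsq /qvec !coE; ring. Qed.

Lemma tensconjE (w : quat C) : tensconj w = qconj w.
Proof. by case: w => [[? ?] [? ?] [? ?] [? ?]]; apply: eq_quat. Qed.

Lemma complex_half : Complex 2^-1 0 = 2^-1 :> C.
Proof. by rewrite -[LHS]/(2^-1%:C)%C fmorphV rmorph_nat. Qed.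

Lemma stem_slice_re (D : set C) (f : slice_fun D) z :
  stem (slice_re f) z = (co1 (stem f z))%:A.
Proof.
by rewrite /= complex_half tensconjE; apply: eq_quat; rewrite !coE /=; field.
Qed.

Lemma stem_slice_vec (D : set C) (f : slice_fun D) z :
  stem (slice_vec f) z = qvec (stem f z).
Proof.
have N1 : Complex (-1) 0 = -1 :> C by rewrite -[LHS]/((-1)%:C)%C rmorphN1.
by rewrite /= complex_half N1 tensconjE; apply: eq_quat; rewrite !coE /=; field.
Qed.

Lemma stem_slice_sym_vec (D : set C) (f : slice_fun D) z :
  stem (slice_sym (slice_vec f)) z = (qnormsq (qvec (stem f z)))%:A.
Proof.
by rewrite -mulq_conj -tensconjE -stem_slice_vec.
Qed.

Lemma stem_star_pow (D : set C) (f : slice_fun D) n z : stem (star_pow f n) z = stem f z ^+ n.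
Proof. by elim: n => [|n IH] //; rewrite exprS -IH. Qed.

(** The imaginary unit and the complex number attached to [q] do not depend on
    the slice function, so a single evaluation map serves all the *-powers. *)
Lemma slice_eval_tens (q : H) : exists I z, qsphere I /\
  forall (D : set C) (f : slice_fun D), f q = tens_eval I (stem f z).
Proof.
pose v := q - (co1 q)%:A; pose b := Num.sqrt (qnormsq v).
have v0 : co1 v = 0 by rewrite /v !coE; ring.
have b2 : b ^+ 2 = coi v ^+ 2 + coj v ^+ 2 + cok v ^+ 2.
  rewrite sqr_sqrtr; last by rewrite /qnormsq !addr_ge0// sqr_ge0.
  by rewrite /qnormsq v0; ring.
exists (if b == 0 then Quat 0 1 0 0 else b^-1 *: v), (Complex (co1 q) b).
split=> //; clearbody b; clearbody v; apply/qsphereP.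
case: eqVneq => [_|b0]; first by split=> //=; ring.
rewrite !coZq v0 mulr0; split=> //.
by rewrite !exprMn -!mulrDr -b2 -exprMn mulVf// expr1n.
Qed.

End StemEvaluation.

(** * Splitting of the *-exponential *)

Section StarExp.
Context {R : realType}.
Local Notation H := (quat R).

(** Geometric growth for the images of the powers of the vector part: these
    images are not themselves powers, as [tens_eval I] is not multiplicative, but
    they satisfy this two-step recursion. *)
Lemma norm_two_step_powers (v : nat -> H) (S : H) : v 0%N = 1 ->
  (forall n, v n.+2 = - S * v n) ->
  forall n, `|v n| <= (1 + `|v 1%N|) * (1 + `|S|) ^+ n.
Proof.
move=> v0 vS.
(* The base is at least 1, so one power of it may be given away at each step. *)
have r1 : 1 <= 1 + `|S| by rewrite lerDl.
have M0 : 0 <= 1 + `|v 1%N| by rewrite addr_ge0.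
suff K n : `|v n| <= (1 + `|v 1%N|) * (1 + `|S|) ^+ n /\
           `|v n.+1| <= (1 + `|v 1%N|) * (1 + `|S|) ^+ n.+1.
  by move=> n; case: (K n).
elim: n => [|n [IH1 IH2]].
  rewrite v0 norm_quat1 expr0 mulr1 expr1; split; first by rewrite lerDl.
  by apply: (@le_trans _ _ (1 + `|v 1%N|)); rewrite ?lerDr// ler_peMr.
split=> //; rewrite vS; apply: (le_trans (ler_norm_quatM _ _)).
rewrite normrN !exprS mulrCA; apply: ler_pM => //; first by rewrite lerDr.
by rewrite mulrCA; apply: (le_trans IH1); rewrite ler_peMl// mulr_ge0.
Qed.

(** The common form of the four cases: [c] and [d] are the values at [f_v^s(q)]
    of the entire functions [cos (sqrt z)] and [sin (sqrt z) / sqrt z]. *)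
Lemma star_exp_re_vec (D : set R[i]) (f : slice_fun D) (q c d : H) :
  let S := slice_sym (slice_vec f) q in
  series (fun n => (n.*2)`!%:R^-1 *: (- S) ^+ n) @ \oo --> c ->
  series (fun n => (n.*2.+1)`!%:R^-1 *: (- S) ^+ n) @ \oo --> d ->
  star_exp f q = star_exp (slice_re f) q * (c + d * slice_vec f q).
Proof.
move=> S cc cd.
have [I [z [II ev]]] := slice_eval_tens q.
set w := stem f z; set V := slice_vec f q.
have VE : V = tens_eval I (qvec w) by rewrite /V ev stem_slice_vec.
have SE : S = tens_eval I (qnormsq (qvec w))%:A by rewrite /S ev stem_slice_sym_vec.
pose A := tens_eval I (co1 w)%:A.
pose v n := tens_eval I (qvec w ^+ n).
have v0 : v 0%N = 1 by rewrite /v expr0 tens_eval1.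
have v1 : v 1%N = V by rewrite /v expr1 VE.
have vS n : v n.+2 = - S * v n.
  rewrite /v -addn2 addnC exprD qvec_sqr mulr_algl tens_evalZ// SE.
  by rewrite scaleNr raddfN.
have v_even n : v n.*2 = (- S) ^+ n.
  by elim: n => [|n IH]; rewrite ?v0// doubleS vS IH exprS.
have v_odd n : v n.*2.+1 = (- S) ^+ n * V.
  by elim: n => [|n IH]; rewrite /= ?v1 ?mul1r// doubleS vS IH mulrA exprS.
pose a n := n`!%:R^-1 *: A ^+ n : H.
pose b n := n`!%:R^-1 *: v n : H.
have aM n : `|a n| <= `|A| ^+ n / n`!%:R.
  rewrite normrZ ger0_norm ?invr_ge0// mulrC ler_wpM2r ?invr_ge0//.
  exact: ler_norm_quatX.
have bM n : `|b n| <= (1 + `|V|) * ((1 + `|S|) ^+ n / n`!%:R).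
  rewrite normrZ ger0_norm ?invr_ge0// mulrC mulrA ler_wpM2r ?invr_ge0//.
  by rewrite -v1; apply: norm_two_step_powers.
have aE : series a @ \oo --> star_exp (slice_re f) q.
  have -> : star_exp (slice_re f) q = limn (series a).
    rewrite /star_exp; congr (limn (series _)); apply/funext => n.
    rewrite ev stem_star_pow stem_slice_re -/w -[X in tens_eval _ X]mulr1.
    by rewrite tens_evalMX// tens_eval1 mulr1.
  apply: (is_cvg_quat_series_exp _ 1 `|A|) => n; rewrite mul1r; exact: aM.
have bE : series b @ \oo --> c + d * V.
  have bC : cvgn (series b) by apply: is_cvg_quat_series_exp bM.
  suff -> : c + d * V = limn (series b) by exact: bC.
  (* The partial sums of even length already determine the limit. *)
  have b2 : (series b \o (fun n => n.*2)) @ \oo --> c + d * V.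
    have -> : series b \o (fun n => n.*2) = (fun n =>
        series (fun k => (k.*2)`!%:R^-1 *: (- S) ^+ k) n +
        series (fun k => (k.*2.+1)`!%:R^-1 *: (- S) ^+ k) n * V).
      apply/funext => n; rewrite /comp series_double; congr (_ + _).
        by congr series; apply/funext => k; rewrite /b v_even.
      rewrite /series/= mulr_suml; apply: eq_bigr => k _.
      by rewrite /b v_odd scalerAl.
    by apply: cvgD => //; apply: cvg_quatM => //; exact: cvg_cst.
  by apply: norm_cvg_unique b2 _; exact: cvg_comp cvg_doublen bC.
rewrite /star_exp; apply: (cvg_lim (@norm_hausdorff _ _)).
rewrite (_ : (fun n => _) = cauchy_prod a b).
  exact: cvg_cauchy_prod aM bM aE bE.
apply/funext => n; rewrite ev stem_star_pow -/w.
rewrite [w in w ^+ n](_ : w = (co1 w)%:A + qvec w); last by rewrite addrC subrK.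
rewrite exprDn_comm; last by rewrite /GRing.comm mulr_algl mulr_algr.
rewrite raddf_sum scaler_sumr; apply: eq_bigr => i _ /=.
have ni : (i <= n)%N by rewrite -ltnS.
rewrite raddfMn/= tens_evalMX// -/A -/(v i) /a /b.
rewrite -[_ *+ 'C(_, _)]scaler_nat -scalerAl -scalerAr !scalerA.
rewrite -(bin_fact ni) !natrM; congr (_ *: _).
have C0 : 'C(n, i)%:R != 0 :> R by rewrite pnatr_eq0 -lt0n bin_gt0.
have i0 : i`!%:R != 0 :> R by rewrite pnatr_eq0 -lt0n fact_gt0.
have n0 : (n - i)`!%:R != 0 :> R by rewrite pnatr_eq0 -lt0n fact_gt0.
by field; rewrite C0 i0 n0.
Qed.

End StarExp.

(** * Summation of the two series *)

Section RealSeries.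
Context {R : realType}.

Lemma cvg_series_cos (x : R) :
  series (fun n => (n.*2)`!%:R^-1 * (- x ^+ 2) ^+ n) @ \oo --> cos x.
Proof.
rewrite (_ : (fun n => _) = cos_coeff' x); first exact: cvg_cos_coeff'.
apply/funext => n; rewrite /cos_coeff' -exprnP.
by rewrite [in LHS]exprNn -exprM mul2n mulrC.
Qed.

Lemma cvg_series_sinc (x : R) : x != 0 ->
  series (fun n => (n.*2.+1)`!%:R^-1 * (- x ^+ 2) ^+ n) @ \oo --> sin x / x.
Proof.
move=> x0; rewrite (_ : series _ = fun N => series (sin_coeff' x) N / x).
  by apply: cvgMr_tmp; exact: cvg_sin_coeff'.
apply/funext => N; rewrite /series/= mulr_suml; apply: eq_bigr => n _.
rewrite /sin_coeff' -exprnP [in LHS]exprNn -exprM mul2n exprSr.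
by rewrite [RHS]mulrAC [X in X / _ / _]mulrA mulfK// mulrC.
Qed.

Lemma cvg_even_series_exp (y : R) :
  (fun n => series (exp_coeff y) n.*2) @ \oo --> expR y.
Proof. exact: cvg_comp cvg_doublen (is_cvg_series_exp_coeff y). Qed.

Lemma cvg_series_cosh (x : R) :
  series (fun n => (n.*2)`!%:R^-1 * (x ^+ 2) ^+ n) @ \oo --> cosh x.
Proof.
rewrite (_ : series _ = fun n => (series (exp_coeff x) n.*2 + series (exp_coeff (- x)) n.*2) / 2).
  by apply: cvgMr_tmp; apply: cvgD; apply: cvg_even_series_exp.
apply/funext => n; rewrite !series_double /series/=.
rewrite addrACA -!big_split mulr_suml.
apply: eq_bigr => k _; rewrite !exp_coeffE /= -!mul2n !(exprS _ (2 * k)) !exprM sqrrN.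
by field; rewrite !pnatr_eq0 -!lt0n !fact_gt0.
Qed.

Lemma cvg_series_sinhc (x : R) : x != 0 ->
  series (fun n => (n.*2.+1)`!%:R^-1 * (x ^+ 2) ^+ n) @ \oo --> sinh x / x.
Proof.
move=> x0.
rewrite (_ : series _ = fun n =>
    (series (exp_coeff x) n.*2 - series (exp_coeff (- x)) n.*2) / 2 / x).
  by apply: cvgMr_tmp; apply: cvgMr_tmp; apply: cvgB; apply: cvg_even_series_exp.
apply/funext => n; rewrite !series_double /series/=.
rewrite opprD addrACA -!sumrB -big_split/= !mulr_suml.
apply: eq_bigr => k _; rewrite !exp_coeffE /= -!mul2n !(exprS _ (2 * k)) !exprM sqrrN.
by field; rewrite x0 !pnatr_eq0 -!lt0n !fact_gt0.
Qed.

(** Stated with [- 0] as this is [- S] for [S = 0]. *)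
Lemma cvg_series_mulX0 (a : nat -> R) :
  series (fun n => a n * (- 0) ^+ n) @ \oo --> a 0%N.
Proof.
apply: cvg_near_cst; exists 1%N => // -[|n]// _.
rewrite /series/= big_nat_recl//= expr0 mulr1 big1 ?addr0// => i _.
by rewrite oppr0 expr0n mulr0.
Qed.

End RealSeries.

Section Cases.
Context {R : realType}.
Local Notation H := (quat R).

Lemma ler_invfact (k l : nat) : (k <= l)%N -> l`!%:R^-1 <= k`!%:R^-1 :> R.
Proof.
move=> kl; rewrite lef_pV2 ?posrE ?ltr0n ?fact_gt0// ler_nat.
exact: leq_fact.
Qed.

Lemma star_exp_real_sym (D : set R[i]) (f : slice_fun D) (q : H) (r c d : R) :
  slice_sym (slice_vec f) q = r%:A ->
  series (fun n => (n.*2)`!%:R^-1 * (- r) ^+ n) @ \oo --> c ->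
  series (fun n => (n.*2.+1)`!%:R^-1 * (- r) ^+ n) @ \oo --> d ->
  star_exp f q = star_exp (slice_re f) q * (c%:A + d *: slice_vec f q).
Proof.
move=> Sr cc cd.
have E n (k : nat) : k`!%:R^-1 *: (- r%:A) ^+ n = (k`!%:R^-1 * (- r) ^+ n)%:A :> H.
  by rewrite -scaleNr exprZn expr1n scalerA.
rewrite (star_exp_re_vec _ _ _ c%:A d%:A) ?mulr_algl// Sr.
  by under eq_fun do rewrite E; exact: cvg_series_scalar.
by under eq_fun do rewrite E; exact: cvg_series_scalar.
Qed.


Lemma cvg_series_qcos (X : H) :
  series (fun n => (n.*2)`!%:R^-1 *: (- X ^+ 2) ^+ n) @ \oo --> qcos X.
Proof.
rewrite (_ : (fun n => _) =
    (fun n => ((-1) ^+ n / (n.*2)`!%:R) *: X ^+ n.*2)); last first.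
  by apply/funext => n; rewrite -scaleN1r exprZn scalerA -exprM mul2n mulrC.
apply: (is_cvg_quat_series_exp _ 1 (`|X| ^+ 2)) => n.
rewrite normrZ normrM normrX normrN1 expr1n !mul1r ger0_norm ?invr_ge0// mulrC.
apply: ler_pM => //; first by rewrite -exprM mul2n; exact: ler_norm_quatX.
by apply: ler_invfact; rewrite -addnn leq_addr.
Qed.

Lemma cvg_series_qsin (X : H) :
  series (fun n => ((-1) ^+ n / (n.*2.+1)`!%:R) *: X ^+ n.*2.+1) @ \oo --> qsin X.
Proof.
apply: (is_cvg_quat_series_exp _ `|X| (`|X| ^+ 2)) => n.
rewrite normrZ normrM normrX normrN1 expr1n !mul1r ger0_norm ?invr_ge0// mulrC.
rewrite mulrA; apply: ler_pM => //; first by rewrite -exprM mul2n -exprS; exact: ler_norm_quatX.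
by apply: ler_invfact; rewrite -addnn -addSn leq_addl.
Qed.

Lemma cvg_series_qsinc (X : H) : X \is a GRing.unit ->
  series (fun n => (n.*2.+1)`!%:R^-1 *: (- X ^+ 2) ^+ n) @ \oo --> qsin X / X.
Proof.
move=> uX.
rewrite (_ : series _ = fun N =>
    series (fun n => ((-1) ^+ n / (n.*2.+1)`!%:R) *: X ^+ n.*2.+1) N / X).
  by apply: cvg_quatM; [exact: cvg_series_qsin|exact: cvg_cst].
apply/funext => N; rewrite /series/= mulr_suml; apply: eq_bigr => n _.
by rewrite -scalerAl [X ^+ n.*2.+1]exprSr mulrK// -scaleN1r exprZn scalerA -exprM mul2n mulrC.
Qed.

Lemma qnormsq_slice (a b : R) (J : H) : qsphere J ->
  qnormsq (a%:A + b *: J) = a ^+ 2 + b ^+ 2.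
Proof.
move=> /qsphereP[J0 J1]; rewrite /qnormsq !coE J0.
by rewrite mulr1 -[b ^+ 2]mulr1 -J1; ring.
Qed.

(** A square root of a nonreal number is nonzero because the norm form is
    multiplicative and does not vanish at that number. *)
Lemma sqrt_nonreal_unit (a b : R) (J X : H) : qsphere J -> b != 0 ->
  X ^+ 2 = a%:A + b *: J -> X \is a GRing.unit.
Proof.
move=> JS b0 X2; change (qnormsq X != 0); apply/eqP => X0.
have /eqP := qnormsqM X X; rewrite -expr2 X2 qnormsq_slice// X0 mul0r.
by rewrite paddr_eq0 ?sqr_ge0// !sqrf_eq0 (negPf b0) andbF.
Qed.

End Cases.

(** * The four cases *)

Theorem corollary4p6 (R : realType) (D : set R[i]) (f : slice_fun D)
    (q0 : quat R) :
  circular_domain D ->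
  circularization D !=set0 ->
  slice_regular f ->
  circularization D q0 ->
  let f0 := slice_re f in
  let fv := slice_vec f in
  let fvs := slice_sym fv in
  [/\ fvs q0 = 0 ->
        star_exp f q0 = star_exp f0 q0 * (1 + fv q0),
      forall r x0 : R, 0 < r -> fvs q0 = r%:A -> x0 ^+ 2 = r ->
        star_exp f q0 =
        star_exp f0 q0 * ((cos x0)%:A + (sin x0 / x0) *: fv q0),
      forall r x0 : R, r < 0 -> fvs q0 = r%:A -> x0 ^+ 2 = - r ->
        star_exp f q0 =
        star_exp f0 q0 * ((cosh x0)%:A + (sinh x0 / x0) *: fv q0)
    & forall (alpha0 beta0 a0 b0 : R) (J : quat R),
        qsphere J -> beta0 != 0 ->
        fvs q0 = alpha0%:A + beta0 *: J ->
        (a0%:A + b0 *: J) ^+ 2 = fvs q0 ->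
        star_exp f q0 =
        star_exp f0 q0 *
        (qcos (a0%:A + b0 *: J) +
         qsin (a0%:A + b0 *: J) / (a0%:A + b0 *: J) * fv q0)].
Proof.
move=> _ _ _ _ f0 fv fvs; split.
- move=> S0; rewrite (star_exp_real_sym _ _ _ 0 1 1) ?scale1r//.
  + by rewrite scale0r.
  + by have := cvg_series_mulX0 (fun n => (n.*2)`!%:R^-1 : R); rewrite invr1.
  + by have := cvg_series_mulX0 (fun n => (n.*2.+1)`!%:R^-1 : R); rewrite invr1.
- move=> r x0 r0 Sr x2.
  have x00 : x0 != 0 by rewrite -sqrf_eq0 x2 gt_eqF.
  apply: (star_exp_real_sym _ _ _ _ _ _ Sr); rewrite -x2.
    exact: cvg_series_cos.
  exact: cvg_series_sinc.
- move=> r x0 r0 Sr x2.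
  have x00 : x0 != 0 by rewrite -sqrf_eq0 x2 oppr_eq0 lt_eqF.
  apply: (star_exp_real_sym _ _ _ _ _ _ Sr); rewrite -x2.
    exact: cvg_series_cosh.
  exact: cvg_series_sinhc.
- move=> a b a0 b0 J JS b_neq0 Sab X2.
  apply: star_exp_re_vec; rewrite -X2; first exact: cvg_series_qcos.
  by apply: cvg_series_qsinc; apply: (sqrt_nonreal_unit a b J) => //; rewrite X2.
Qed.
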